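(* Let $G$ be a graph on $n$ vertices which is neither the complete graph $K_n$ nor $K_n - e$ (the complete graph on $n$ vertices with one edge deleted). Then the $n$-Bell colour graph $\mathcal{B}_n(G)$ is Hamiltonian.
   Context: Graphs are finite and simple. For a graph $G$ and a positive integer $k$, the $k$-Bell colour graph of $G$, denoted $\mathcal{B}_k(G)$, is the graph whose vertices are the partitions of $V(G)$ into $k$ or fewer (non-empty) independent sets, with different partitions $p_1$ and $p_2$ being adjacent if there is a vertex $x \in V(G)$ such that the restrictions of $p_1$ and $p_2$ to $V(G)-\{x\}$ are equal (after restriction, empty cells are discarded). A graph is Hamiltonian if it has a cycle containing all of its vertices; in particular a Hamiltonian graph has at least three vertices, so $K_1$ and $K_2$ are not Hamiltonian. *)

(* Defs.v *)
From HB Require Import structures.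
From mathcomp Require Import all_boot.

Set Implicit Arguments.
Unset Strict Implicit.
Unset Printing Implicit Defensive.

Record sgraph := SGraph {
  vertex :> finType;
  adj : rel vertex;
  adj_sym : symmetric adj;
  adj_irr : irreflexive adj }.

Definition is_complete (G : sgraph) : Prop :=
  forall u v : G, adj u v = (u != v).

Definition is_complete_minus_edge (G : sgraph) : Prop :=
  exists x y : G, x != y /\
    forall u v : G, adj u v = (u != v) && ([set u; v] != [set x; y]).

(* The size condition is needed: [ucycle] also accepts the empty sequence and
   the back-and-forth closed walk along a single edge. *)
Definition hamiltonian (G : sgraph) : Prop :=
  exists s : seq G, [/\ 2 < size s, ucycle (@adj G) s & forall x : G, x \in s].

Definition independent (G : sgraph) (A : {set G}) : bool :=
  [forall u in A, forall v in A, ~~ adj u v].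

(* [partition] already requires the cells to be non-empty. *)
Definition stable_partition (k : nat) (G : sgraph) : pred {set {set G}} :=
  fun p => [&& partition p [set: G], #|p| <= k
             & [forall A in p, independent A]].

Definition restr (T : finType) (p : {set {set T}}) (x : T) : {set {set T}} :=
  [set A :\ x | A in p] :\ set0.

Section BellColourGraph.

Variables (k : nat) (G : sgraph).

Definition bell_vertex : finType :=
  {p : {set {set G}} | stable_partition k p}.

Definition bell_adj : rel bell_vertex := fun p1 p2 =>
  (p1 != p2) && [exists x : G, restr (val p1) x == restr (val p2) x].

Lemma bell_adj_sym : symmetric bell_adj.
Proof.
move=> p1 p2; rewrite /bell_adj eq_sym; congr (_ && _).
by apply: eq_existsb => x; rewrite eq_sym.
Qed.

Lemma bell_adj_irr : irreflexive bell_adj.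
Proof. by move=> p; rewrite /bell_adj eqxx. Qed.

Definition bell_colour_graph : sgraph := SGraph bell_adj_sym bell_adj_irr.

End BellColourGraph.

(* Main.v *)
Require Import Defs.
From mathcomp Require Import all_boot.

Set Implicit Arguments.
Unset Strict Implicit.
Unset Printing Implicit Defensive.

(** Call a pair of distinct non-adjacent vertices of G a free pair: these are
the pairs that may share a cell. The proof is an induction on vertex sets W: the
graph of all partitions of W into independent sets has a Hamiltonian cycle, a
single partition or two linked partitions counting as degenerate cycles
([cyclable_parts]).

The step deletes a free pair x, y. Fix a partition q of the remaining set. The
partitions that extend q are given by a cell of q that x joins, if any, and a cell
of q that y joins, if any, together with one more partition in which {x, y} is a
cell. Moving x or moving y makes them a rook graph with one extra
vertex ([board], [seat_link], [seat_imset]). Two members of this fibre exist for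
every q: [apart q], where x and y are singletons, and [joined q], where {x, y} is
a cell. If q and q' differ by moving one vertex, then so do [apart q] and
[apart q'], and so do [joined q] and [joined q'] ([link_side]). A rook graph has
a Hamiltonian path from apart to joined ([ham_fibre]), so a cycle of even
length q_1, ..., q_m of smaller partitions lifts: cross the fibres alternately
from apart to joined and from joined to apart ([ham_zigzag]).

If m is odd, one fibre must be left at a third level, and this is where the pair
x, y has to be chosen well. Suppose that x forms a free pair with some further
vertex t. In the fibre of the discrete partition D, end at the partition
[beside D t] with the cell {x, t}. The successor q_1 of D on the cycle either
still has {t} as a cell, and then [beside D t] is linked to [beside q_1 t]; or
passing from D to q_1 is a move of t, and then [beside D t] is linked to
[apart q_1] ([link_discrete]). Both fibres have Hamiltonian paths with the
required ends ([ham_fibre_origin], [ham_fibre_joined]), which repairs the parity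
([cyclable_add]).

If no vertex lies in two free pairs, the free pairs form a matching. If one of
them remains after the deletion of x and y, then the fibres obtained by deleting it
in its turn have exactly two elements each, so m is even ([even_parts]); and if none
remains, m = 1.

At least two free pairs exist when G is neither complete nor complete minus an
edge, so there are at least three partitions and the cycle is a genuine one. *)

(** * Hamiltonian paths on subsets of a finite type *)

Section HamPath.
Variables (U : finType) (e : rel U).
Implicit Types (A B : {set U}) (u v : U).

(** The relation may be reflexive: repetitions are excluded by [uniq]. *)
Definition ham_path A u v : Prop :=
  exists s, [/\ path e u s, last u s = v, uniq (u :: s) & u :: s =i A].

Lemma ham_path_rev A u v : symmetric e -> ham_path A u v -> ham_path A v u.
Proof.
move=> e_sym [s [ps <- us As]]; exists (rev (belast u s)).
have Erev: last u s :: rev (belast u s) = rev (u :: s).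
  by rewrite [u :: s]lastI rev_rcons.
split.
- by rewrite rev_path (eq_path (e' := e)) // => a b; rewrite e_sym.
- by move: (congr1 (last v) Erev); rewrite /= => ->; rewrite rev_cons last_rcons.
- by rewrite Erev rev_uniq.
- by move=> w; rewrite Erev mem_rev As.
Qed.

Lemma ham_path_cat A B u v u' v' :
  [disjoint A & B] -> e v u' ->
  ham_path A u v -> ham_path B u' v' -> ham_path (A :|: B) u v'.
Proof.
move=> dAB evu [s [ps ls us As]] [t [pt lt ut Bt]]; exists (s ++ u' :: t); split.
- by rewrite cat_path ps ls /= evu.
- by rewrite last_cat /= lt.
- rewrite -cat_cons cat_uniq us ut andbT; apply/hasPn => w.
  rewrite Bt As => wB; apply/negP => wA.
  by move/pred0P/(_ w): dAB => /=; rewrite wA wB.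
- by move=> w; rewrite -cat_cons mem_cat As Bt inE.
Qed.

Lemma ham_path1 u : ham_path [set u] u u.
Proof. by exists [::]; split=> // w; rewrite !inE. Qed.

Lemma path_clique A u s :
  {in A &, forall a b, e a b} -> {subset u :: s <= A} -> path e u s.
Proof.
move=> eA; elim: s u => //= w s IHs u sA.
rewrite eA ?sA ?inE ?eqxx ?orbT //=; apply: IHs => z zs.
by apply: sA; rewrite inE zs orbT.
Qed.

Lemma ham_path_clique A u v :
  {in A &, forall a b, e a b} -> u \in A -> v \in A -> u != v -> ham_path A u v.
Proof.
move=> eA uA vA neq_uv; exists (rcons (enum (A :\ u :\ v)) v).
have memA: u :: rcons (enum (A :\ u :\ v)) v =i A.
  move=> w; rewrite inE mem_rcons inE mem_enum !inE.
  by case: eqVneq => [-> // | _]; case: eqVneq => [-> | _].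
split=> //.
- by apply: (path_clique (A := A)) => // w; rewrite memA.
- by rewrite last_rcons.
- rewrite cons_uniq rcons_uniq enum_uniq mem_rcons inE !mem_enum !inE eqxx /=.
  by rewrite (negPf neq_uv) !eqxx.
Qed.

Lemma ham_path_clique_from A u :
  {in A &, forall a b, e a b} -> u \in A -> exists2 v, v \in A & ham_path A u v.
Proof.
move=> eA uA; have [A0 | [v]] := set_0Vmem (A :\ u).
  exists u => //; have -> : A = [set u].
    by rewrite -(setD1K uA) A0 setU0.
  exact: ham_path1.
rewrite !inE eq_sym => /andP[neq_uv vA].
by exists v => //; apply: ham_path_clique.
Qed.

End HamPath.

Lemma ham_path_imset (U V : finType) (e : rel U) (e' : rel V) (f : U -> V)
    (A : {set U}) u v :
  {in A &, injective f} -> {in A &, forall a b, e a b -> e' (f a) (f b)} ->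
  ham_path e A u v -> ham_path e' (f @: A) (f u) (f v).
Proof.
move=> injf homf [s [ps <- us As]]; exists (map f s).
have sA: {subset u :: s <= A} by move=> w; rewrite As.
split.
- elim: s u ps sA {us As} => //= w s IHs u /andP[euw pws] sA.
  rewrite homf ?sA ?inE ?eqxx ?orbT //=; apply: IHs => // z zs.
  by apply: sA; rewrite inE zs orbT.
- by rewrite last_map.
- by rewrite -map_cons map_inj_in_uniq // => a b /sA aA /sA bA; apply: injf.
- move=> w; rewrite -map_cons; apply/mapP/imsetP => -[a aA ->]; exists a => //.
    by rewrite -As.
  by rewrite As.
Qed.

(** * Rook graphs with an extra vertex *)

Section Rook.
Variables (I J : finType) (r0 : I) (c0 : J).

(** [Some (a, b)] is the square in row a and column b. The extra vertex [None] is
adjacent to the row r0 and to the column c0, hence it extends the two cliques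
through the square (r0, c0). *)
Definition rook (p q : option (I * J)) : bool :=
  match p, q with
  | Some (a, b), Some (a', b') => (a == a') || (b == b')
  | Some (a, b), None | None, Some (a, b) => (a == r0) || (b == c0)
  | None, None => true
  end.

Definition grid (A : {set I}) (B : {set J}) : {set option (I * J)} :=
  [set p | if p is Some (a, b) then (a \in A) && (b \in B) else false].

(** The rows can be exhausted one after the other, because a row can be left in any
column; the price is that the last square is not prescribed. *)
Lemma ham_grid (A : {set I}) (B : {set J}) a b : a \in A -> b \in B ->
  exists c d, [/\ c \in A, d \in B
                & ham_path rook (grid A B) (Some (a, b)) (Some (c, d))].
Proof.
elim: {A}#|A| {-2}A (erefl #|A|) a b => [|n IHn] A cardA a b aA bB.
  by move/eqP: cardA aA; rewrite cards_eq0 => /eqP->; rewrite inE.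
have row_clique: {in grid [set a] B &, forall p q, rook p q}.
  case=> [[a1 b1]|] [[a2 b2]|] //=; rewrite !inE //.
  by move=> /andP[/eqP-> _] /andP[/eqP-> _]; rewrite eqxx.
have [|[[c d]|]] := ham_path_clique_from row_clique (u := Some (a, b)).
- by rewrite !inE eqxx.
- rewrite !inE => /andP[/eqP-> dB] row_path; have [A0|[a' a'A]] := set_0Vmem (A :\ a).
    exists a, d; split=> //; suff -> : A = [set a] by [].
    by rewrite -(setD1K aA) A0 setU0.
  have cardA' : #|A :\ a| = n by move: cardA; rewrite (cardsD1 a) aA => -[].
  have [c' [d' [c'A d'B rest_path]]] := IHn _ cardA' a' d a'A dB.
  exists c', d'; split=> //; first by move: c'A; rewrite inE => /andP[].
  have -> : grid A B = grid [set a] B :|: grid (A :\ a) B.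
    apply/setP => -[[p q]|]; rewrite !inE //.
    by case: eqVneq => [->|_] /=; rewrite ?aA ?orbF.
  apply: ham_path_cat row_path rest_path; last by rewrite /= eqxx orbT.
  apply/pred0P => -[[p q]|] /=; rewrite !inE //.
  by case: (eqVneq p a) => //=; rewrite andbF.
- by rewrite inE.
Qed.

Variables (A : {set I}) (B : {set J}).
Hypotheses (r0A : r0 \notin A) (c0B : c0 \notin B).

Definition board : {set option (I * J)} := None |: grid (r0 |: A) (c0 |: B).

Lemma head_clique : {in None |: grid [set r0] (c0 |: B) &, forall p q, rook p q}.
Proof.
case=> [[a1 b1]|] [[a2 b2]|] //=; rewrite !inE //=.
- by move=> /andP[/eqP-> _] /andP[/eqP-> _]; rewrite eqxx.
- by move=> /andP[/eqP-> _]; rewrite eqxx.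
- by move=> _ /andP[/eqP-> _]; rewrite eqxx.
Qed.

Lemma boardE : board = grid A (c0 |: B) :|: (None |: grid [set r0] (c0 |: B)).
Proof.
apply/setP => -[[p q]|]; rewrite !inE //=.
by case: (p == r0); case: (p \in A); case: (q == c0); case: (q \in B).
Qed.

Lemma disjoint_head : [disjoint grid A (c0 |: B) & None |: grid [set r0] (c0 |: B)].
Proof.
apply/pred0P => -[[p q]|] /=; rewrite !inE //=.
by case: (eqVneq p r0) => [->|_]; rewrite ?(negPf r0A) ?andbF.
Qed.

(** Sweep the rows of A first; wherever this ends, the column leads into row r0,
which forms a clique with [None]. *)
Lemma ham_board_None a : a \in A -> ham_path rook board (Some (a, c0)) None.
Proof.
move=> aA; have [|c [d [cA dB grid_path]]] := @ham_grid A (c0 |: B) a c0 aA.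
  by rewrite !inE eqxx.
rewrite boardE; apply: (ham_path_cat (u' := Some (r0, d)) disjoint_head _ grid_path).
  by rewrite /= eqxx orbT.
apply: ham_path_clique head_clique _ _ _ => //; first by rewrite !inE eqxx in dB *.
by rewrite !inE.
Qed.

(** Backwards: sweep the rows of A from (a, c0). If this ends in column c0, the
square of row r0 in that column has to be kept for the end, so the path enters the
clique of row r0 at [None] instead. *)
Lemma ham_board_origin a : a \in A ->
  ham_path rook board (Some (r0, c0)) (Some (a, c0)).
Proof.
have rook_sym : symmetric rook.
  by case=> [[a1 b1]|] [[a2 b2]|] //=; rewrite [a1 == _]eq_sym [b1 == _]eq_sym.
move=> aA; apply: ham_path_rev => //.
have [|c [d [cA dB grid_path]]] := @ham_grid A (c0 |: B) a c0 aA.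
  by rewrite !inE eqxx.
pose z := if d == c0 then None else Some (r0, d).
rewrite boardE; apply: (ham_path_cat (u' := z) disjoint_head _ grid_path).
  by rewrite /z /=; case: eqP; rewrite ?orbT ?eqxx ?orbT.
apply: ham_path_clique head_clique _ _ _; rewrite /z.
- by case: ifP; rewrite !inE ?eqxx //= in dB *.
- by rewrite !inE !eqxx.
- by case: (eqVneq d c0) => // neq_dc; apply/eqP => -[Edc]; rewrite Edc eqxx in neq_dc.
Qed.

(** A sweep of all rows of A from column c0 might end in column c0 again, where
the only square of row r0 is the starting one. Sweeping column c0 first and the
other columns afterwards avoids this. *)
Lemma ham_board : ham_path rook board (Some (r0, c0)) None.
Proof.
have [A0 | [a aA]] := set_0Vmem A.
  have -> : board = None |: grid [set r0] (c0 |: B) by rewrite /board A0 setU0.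
  by apply: ham_path_clique head_clique _ _ _; rewrite // !inE ?eqxx.
have col_clique (A' : {set I}) : {in None |: grid A' [set c0] &, forall p q, rook p q}.
  case=> [[a1 b1]|] [[a2 b2]|] //=; rewrite !inE //=.
  - by move=> /andP[_ /eqP->] /andP[_ /eqP->]; rewrite eqxx orbT.
  - by move=> /andP[_ /eqP->]; rewrite eqxx orbT.
  - by move=> _ /andP[_ /eqP->]; rewrite eqxx orbT.
have [B0 | [b bB]] := set_0Vmem B.
  have -> : board = None |: grid (r0 |: A) [set c0] by rewrite /board B0 setU0.
  by apply: ham_path_clique (@col_clique _) _ _ _; rewrite // !inE ?eqxx.
have subcol : {in grid A [set c0] &, forall p q, rook p q}.
  by move=> p q pA qA; apply: (col_clique A); rewrite inE ?pA ?qA orbT.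
have [|z zA col_path] := ham_path_clique_from subcol (u := Some (a, c0)).
  by rewrite !inE aA eqxx.
case: z zA col_path => [[c d]|]; rewrite !inE // => /andP[cA /eqP->] col_path.
have [c' [d' [c'A d'B grid_path]]] := ham_grid cA bB.
have neq_d'c0 : d' != c0 by apply: contraNneq c0B => <-.
have head_path : ham_path rook (None |: grid [set r0] B) (Some (r0, d')) None.
  apply: ham_path_clique => //; last 2 first.
  - by rewrite !inE eqxx.
  - by rewrite !inE.
  move=> p q pA qA; apply: head_clique.
    by case: p pA => [[i j]|]; rewrite !inE //= => /andP[-> ->]; rewrite orbT.
  by case: q qA => [[i j]|]; rewrite !inE //= => /andP[-> ->]; rewrite orbT.
have -> : board = [set Some (r0, c0)] :|: (grid A [set c0] :|:
   (grid A B :|: (None |: grid [set r0] B))).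
  apply/setP => -[[p q]|]; rewrite !inE //=.
  have -> : (Some (p, q) == Some (r0, c0)) = (p == r0) && (q == c0) by [].
  by case: (p == r0); case: (q == c0); case: (p \in A); case: (q \in B).
apply: (ham_path_cat (u' := Some (a, c0))) (ham_path1 _ _) _.
- apply/pred0P => -[[p q]|] /=; rewrite !inE //=.
  have -> : (Some (p, q) == Some (r0, c0)) = (p == r0) && (q == c0) by [].
  case: (eqVneq p r0) => //= ->; case: (eqVneq q c0) => //= ->.
  by rewrite (negPf r0A) (negPf c0B).
- by rewrite /= eqxx orbT.
apply: (ham_path_cat (u' := Some (c, b))) col_path _.
- apply/pred0P => -[[p q]|] /=; rewrite !inE //=.
  case: (eqVneq q c0) => [->|_]; last by rewrite !andbF.
  rewrite (negPf c0B) !andbF; by [].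
- by rewrite /= eqxx.
apply: (ham_path_cat (u' := Some (r0, d'))) grid_path head_path.
- apply/pred0P => -[[p q]|] /=; rewrite !inE //=.
  by case: (eqVneq p r0) => [->|_]; rewrite ?(negPf r0A) ?andbF.
- by rewrite /= eqxx orbT.
Qed.

End Rook.

(** * Inserting a vertex into a partition and deleting it *)

Section Placement.
Variable T : finType.
Implicit Types (P Q : {set {set T}}) (A B C W : {set T}) (x y z : T).

(** The cell C is allowed to be empty, in which case x becomes a singleton: P does
not contain the empty set. The admissible C are thus the elements of
[set0 |: P]. *)
Definition place P x C : {set {set T}} := (x |: C) |: (P :\ C).

Lemma setD1_notin A x : x \notin A -> A :\ x = A.
Proof.
by move=> xA; apply/setDidPl; rewrite disjoint_sym disjoints1.
Qed.

Lemma partition_cell P W A : partition P W -> A \in P -> A != set0 /\ A \subset W.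
Proof.
move=> parP AP; split; last first.
  by rewrite -(cover_partition parP); apply: bigcup_sup.
by apply: contraTneq AP => ->; rewrite (partition0 parP).
Qed.

Lemma cell_eq P W A B z :
  partition P W -> A \in P -> B \in P -> z \in A -> z \in B -> A = B.
Proof.
move=> parP AP BP zA zB; have tP := partition_trivIset parP.
by rewrite -(def_pblock tP AP zA) (def_pblock tP BP zB).
Qed.

Lemma slot_notin P W C x :
  partition P W -> x \notin W -> C \in set0 |: P -> x \notin C.
Proof.
move=> parP xW; rewrite !inE => /orP[/eqP->|CP]; first by rewrite inE.
by have [_ /subsetP sCW] := partition_cell parP CP; apply: contra xW => /sCW.
Qed.

Lemma slot_eq P W A C z : partition P W -> A \in P -> C \in set0 |: P ->
  z \in A -> z \in C -> A = C.
Proof.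
move=> parP AP; rewrite !inE => /orP[/eqP->|CP] zA; first by rewrite inE.
exact: cell_eq parP AP CP zA.
Qed.

Lemma mem_restr P x B :
  reflect (B != set0 /\ exists2 A, A \in P & B = A :\ x) (B \in restr P x).
Proof.
by rewrite in_setD1; apply: (iffP andP) => -[B0 /imsetP BP].
Qed.

Lemma slot_restr P x C : C \in set0 |: P -> C :\ x \in set0 |: restr P x.
Proof.
rewrite in_setU1 => /orP[/eqP->|CP].
  by rewrite set0D in_setU1 eqxx.
rewrite in_setU1; case: eqVneq => //= Cx.
by apply/mem_restr; split=> //; exists C.
Qed.

Lemma restr_notin P W x : partition P W -> x \notin W -> restr P x = P.
Proof.
move=> parP xW; have P_x A : A \in P -> A :\ x = A.
  by move=> AP; rewrite setD1_notin // (slot_notin parP xW) // inE AP orbT.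
apply/setP => B; apply/mem_restr/idP => [[_ [A AP ->]]|BP]; first by rewrite P_x.
by split; [case: (partition_cell parP BP) | exists B; rewrite ?P_x].
Qed.

Lemma restr_place P W x C : partition P W -> x \notin W -> C \in set0 |: P ->
  restr (place P x C) x = P.
Proof.
move=> parP xW slotC; have xC := slot_notin parP xW slotC.
apply/setP => B; apply/mem_restr/idP.
  case=> B0 [A]; rewrite !inE => /orP[/eqP->|/andP[_ AP]] defB.
    by move: slotC B0; rewrite defB setU1K // !inE => /orP[->|].
  by rewrite defB setD1_notin // (slot_notin parP xW) // inE AP orbT.
move=> BP; split; first by case: (partition_cell parP BP).
have [->|neqBC] := eqVneq B C; first by exists (x |: C); rewrite ?setU1K // !inE eqxx.
exists B; first by rewrite !inE neqBC BP orbT.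
by rewrite setD1_notin // (slot_notin parP xW) // inE BP orbT.
Qed.

(** Adjacency only refers to restrictions, so this commutation is what carries a
move of y over to partitions that have been enlarged by x. It also covers the case
where y is alone in C, because then x becomes a singleton. *)
Lemma restr_place_neq P W x y C : partition P W -> C \in set0 |: P -> y != x ->
  restr (place P x C) y = place (restr P y) x (C :\ y).
Proof.
move=> parP slotC neq_yx.
have Dxy : (x |: C) :\ y = x |: (C :\ y).
  apply/setP => z; rewrite !inE; case: (eqVneq z x) => [->|] //=.
  by rewrite eq_sym neq_yx.
apply/setP => B; apply/mem_restr/idP.
  case=> B0 [A]; rewrite !inE => /orP[/eqP->|/andP[neqAC AP]] defB.
    by rewrite defB Dxy eqxx.
  rewrite B0 /=; apply/orP; right; apply/andP; split; last first.
    by apply/imsetP; exists A.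
  apply: contraNneq neqAC => BC; have [z zB] := set0Pn _ B0.
  have zA: z \in A by move: zB; rewrite defB inE => /andP[].
  have zC: z \in C by move: zB; rewrite BC inE => /andP[].
  by rewrite (slot_eq parP AP slotC zA zC).
rewrite in_setU1 => /orP[/eqP->|].
  split; first by apply/set0Pn; exists x; rewrite !inE eqxx.
  by exists (x |: C); rewrite ?Dxy // !inE eqxx.
rewrite in_setD1 => /andP[neqBC /mem_restr[B0 [A AP defB]]]; split=> //.
exists A => //; rewrite !inE AP andbT; apply/orP; right.
by apply: contraNneq neqBC => <-; rewrite defB.
Qed.

Lemma place_restr P W x : partition P W -> x \in W ->
  place (restr P x) x (pblock P x :\ x) = P.
Proof.
move=> parP xW; have covP := cover_partition parP.
have BP: pblock P x \in P by rewrite pblock_mem ?covP.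
have xB: x \in pblock P x by rewrite mem_pblock covP.
apply/setP => A; rewrite /place setD1K // in_setU1 in_setD1.
apply/orP/idP => [[/eqP-> // | /andP[neqA /mem_restr[_ [B B_P defA]]]] | AP].
  have xNB : x \notin B.
    apply: contra neqA => xB'.
    by rewrite defA (cell_eq parP B_P BP xB' xB).
  by rewrite defA setD1_notin.
have [->|neqA] := eqVneq A (pblock P x); [by left | right].
have xNA : x \notin A by apply: contraNN neqA => xA; rewrite (cell_eq parP AP BP xA xB).
have [A0 _] := partition_cell parP AP.
apply/andP; split; last by apply/mem_restr; split=> //; exists A; rewrite ?setD1_notin.
apply: contraNneq neqA => defA; have [z zA] := set0Pn _ A0.
have zB: z \in pblock P x by move: zA; rewrite defA inE => /andP[].
by rewrite (cell_eq parP AP BP zA zB).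
Qed.

Lemma place_inj P W x C C' : partition P W -> x \notin W ->
  C \in set0 |: P -> C' \in set0 |: P -> place P x C = place P x C' -> C = C'.
Proof.
move=> parP xW slotC slotC' eq_place.
have: x |: C \in place P x C' by rewrite -eq_place setU11.
rewrite !inE => /orP[/eqP Cx | /andP[_ CP]].
  by rewrite -(setU1K (slot_notin parP xW slotC)) Cx setU1K // (slot_notin parP xW slotC').
have: x \notin x |: C by apply: slot_notin parP xW _; rewrite inE CP orbT.
by rewrite setU11.
Qed.

Lemma partition_restr P W x : partition P W -> partition (restr P x) (W :\ x).
Proof.
move=> parP; apply/and3P; split.
- apply/eqP/setP => z; rewrite in_setD1 -(cover_partition parP).
  apply/bigcupP/andP => [[B /mem_restr[_ [A AP ->]]]|[zx /bigcupP[A AP zA]]].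
    by rewrite in_setD1 => /andP[-> zA]; split=> //; apply/bigcupP; exists A.
  have zAx: z \in A :\ x by rewrite in_setD1 zx.
  exists (A :\ x) => //; apply/mem_restr; split; last by exists A.
  by apply/set0Pn; exists z.
- apply/trivIsetP => A' B' /mem_restr[_ [A AP ->]] /mem_restr[_ [B BP ->]] neqAB.
  apply/pred0P => z /=; apply/negP => /andP[].
  rewrite !in_setD1 => /andP[_ zA] /andP[_ zB].
  by rewrite (cell_eq parP AP BP zA zB) eqxx in neqAB.
- by rewrite !inE eqxx.
Qed.

Lemma partition_place P W x C : partition P W -> x \notin W -> C \in set0 |: P ->
  partition (place P x C) (x |: W).
Proof.
move=> parP xW slotC; apply/and3P; split.
- apply/eqP/setP => z; rewrite in_setU1 -(cover_partition parP).
  apply/bigcupP/orP => [[A]|].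
    rewrite !inE => /orP[/eqP->|/andP[_ AP] zA]; last first.
      by right; apply/bigcupP; exists A.
    rewrite !inE => /orP[->|zC]; [by left | right].
    move: slotC; rewrite !inE => /orP[/eqP C0|CP]; first by rewrite C0 inE in zC.
    by apply/bigcupP; exists C.
  case=> [/eqP->|/bigcupP[A AP zA]]; first by exists (x |: C); rewrite !inE eqxx.
  have [AC|neqAC] := eqVneq A C.
    by exists (x |: C); rewrite -?AC !inE ?eqxx ?zA ?orbT.
  by exists A; rewrite // !inE neqAC AP orbT.
- have disC A : A \in P :\ C -> [disjoint x |: C & A].
    rewrite !inE => /andP[neqAC AP]; apply/pred0P => z /=; apply/negP => /andP[].
    rewrite !inE => /orP[/eqP->|zC] zA.
      by move: zA; apply/negP; apply: slot_notin parP xW _; rewrite inE AP orbT.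
    by rewrite (slot_eq parP AP slotC zA zC) eqxx in neqAC.
  apply/trivIsetP => A B; rewrite (in_setU1 A) (in_setU1 B).
  case/orP=> [/eqP->|AP] /orP[/eqP->|BP]; rewrite ?eqxx //.
  + by move=> _; apply: disC.
  + by move=> _; rewrite disjoint_sym; apply: disC.
  + move: AP BP; rewrite !inE => /andP[_ AP] /andP[_ BP].
    exact: (trivIsetP (partition_trivIset parP)).
- rewrite !inE negb_or (partition0 parP) andbF andbT.
  by rewrite eq_sym; apply/set0Pn; exists x; rewrite setU11.
Qed.

Definition discrete W : {set {set T}} := [set [set v] | v in W].

Lemma partition_discrete W : partition (discrete W) W.
Proof.
apply/and3P; split.
- apply/eqP/setP => z; apply/bigcupP/idP => [[A /imsetP[v vW ->]]|zW].
    by rewrite inE => /eqP->.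
  by exists [set z]; rewrite ?inE //; apply/imsetP; exists z.
- apply/trivIsetP => A B /imsetP[v _ ->] /imsetP[w _ ->] neq_vw.
  by rewrite disjoints1 inE; apply: contraNN neq_vw => /eqP->.
- by apply/imsetP => -[v _ /setP/(_ v)]; rewrite !inE eqxx.
Qed.

Lemma mem_discrete W v : ([set v] \in discrete W) = (v \in W).
Proof. by apply: mem_imset; apply: set1_inj. Qed.

Lemma restr_discrete W x : restr (discrete W) x = discrete (W :\ x).
Proof.
apply/setP => B; apply/mem_restr/imsetP => [[B0 [A /imsetP[v vW ->] defB]]|[v]].
  have neq_vx : v != x by apply: contraNneq B0 => vx; rewrite defB vx setDv.
  exists v; first by rewrite !inE neq_vx.
  by rewrite defB setD1_notin // inE eq_sym.
rewrite !inE => /andP[neq_vx vW] ->; split.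
  by apply/set0Pn; exists v; rewrite inE.
by exists [set v]; rewrite ?mem_discrete ?setD1_notin // inE eq_sym.
Qed.

Lemma place_restr_single P W x : partition P W -> [set x] \in P ->
  place (restr P x) x set0 = P.
Proof.
move=> parP xP; have [_ /subsetP sxW] := partition_cell parP xP.
rewrite -[RHS](place_restr (x := x) parP) ?sxW ?inE //.
by rewrite (def_pblock (partition_trivIset parP) xP) ?inE // setDv.
Qed.

(** The adjacency of Bell colour graphs made reflexive: distinctness comes for free
along duplicate-free paths. *)
Definition link : rel {set {set T}} := fun P Q => [exists x, restr P x == restr Q x].

Lemma link_at P Q x : restr P x = restr Q x -> link P Q.
Proof. by move=> eqPQ; apply/existsP; exists x; rewrite eqPQ. Qed.

Lemma link_sym : symmetric link.
Proof. by move=> P Q; apply: eq_existsb => x; rewrite eq_sym. Qed.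

(** Linked to the discrete partition are, besides itself, those with exactly one
cell of size 2; if t is not alone in P, it is in this cell, and moving t merges
its two elements just as well as moving the other one. *)
Lemma link_discrete P W t : partition P W -> t \in W -> link (discrete W) P ->
  [set t] \notin P -> restr (discrete W) t = restr P t.
Proof.
move=> parP tW /existsP[s /eqP eqs] tP.
have [-> // | neq_ts] := eqVneq t s.
have parD := partition_discrete W; have tD: [set t] \in discrete W by rewrite mem_discrete.
have [sW|sW] := boolP (s \in W); last first.
  by move: tP; rewrite -(restr_notin parP sW) -eqs (restr_notin parD sW) tD.
set Q := restr P s in eqs; have parQ: partition Q (W :\ s) by apply: partition_restr.
have defP := place_restr parP sW; rewrite -/Q in defP.
set C := _ :\ s in defP.
have slotC : C \in set0 |: Q.
  apply: slot_restr; rewrite in_setU1 pblock_mem ?orbT //.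
  by rewrite (cover_partition parP).
have tQ : [set t] \in Q by rewrite -eqs restr_discrete mem_discrete !inE neq_ts.
have defC : C = [set t].
  apply/eqP/negPn/negP => neqC; case/negP: tP.
  by rewrite -defP in_setU1 in_setD1 tQ [_ == C]eq_sym neqC orbT.
have sD : [set s] \in discrete W by rewrite mem_discrete.
rewrite -(place_restr_single parD sD) eqs -defP.
rewrite !(restr_place_neq (W := W :\ s)) //; last by rewrite !inE eqxx.
by rewrite defC setDv set0D.
Qed.

End Placement.

Arguments link {T}.

(** * Partitions into independent sets *)

Section Stable.
Variable G : sgraph.
Implicit Types (P Q R q : {set {set G}}) (A B C W : {set G}) (x y t : G).

Lemma independentP A :
  reflect {in A &, forall u v, ~~ adj u v} (independent A).
Proof.
apply: (iffP forall_inP) => indA u; first by move=> v uA vA; have /forall_inP := indA u uA; apply.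
by move=> uA; apply/forall_inP => v; apply: indA.
Qed.

Lemma independentS A B : A \subset B -> independent B -> independent A.
Proof.
by move=> /subsetP sAB /independentP indB; apply/independentP => u v /sAB uB /sAB; apply: indB.
Qed.

Lemma independent2 x y : independent [set x; y] = ~~ adj x y.
Proof.
apply/independentP/idP => [-> //|nxy u v]; rewrite ?inE ?eqxx ?orbT //.
by move=> /orP[]/eqP-> /orP[]/eqP->; rewrite ?adj_irr // adj_sym.
Qed.

Lemma independent1 x : independent [set x].
Proof. by apply/independentP => u v; rewrite !inE => /eqP-> /eqP->; rewrite adj_irr. Qed.

Lemma independentU0 x : independent (x |: set0).
Proof. by rewrite setU0; apply: independent1. Qed.

(** The induction runs over vertex sets W of one fixed graph, which spares a change
of type for the induced subgraphs. *)
Definition parts W : {set {set {set G}}} :=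
  [set P | partition P W & [forall A in P, independent A]].

Lemma partsP W P : reflect
  (partition P W /\ {in P, forall A, independent A}) (P \in parts W).
Proof. by rewrite inE; apply: (iffP andP) => -[parP /forall_inP]. Qed.

Lemma parts_partition W P : P \in parts W -> partition P W.
Proof. by case/partsP. Qed.

Lemma parts_restr W P x : P \in parts W -> restr P x \in parts (W :\ x).
Proof.
case/partsP=> parP indP; apply/partsP; split; first exact: partition_restr.
move=> _ /mem_restr[_ [A AP ->]]; exact: independentS (subD1set _ _) (indP A AP).
Qed.

Lemma parts_place W P x C : P \in parts W -> x \notin W -> C \in set0 |: P ->
  independent (x |: C) -> place P x C \in parts (x |: W).
Proof.
case/partsP=> parP indP xW slotC indC; apply/partsP; split.
  exact: partition_place.
by move=> A; rewrite !inE => /orP[/eqP->|/andP[_ /indP]].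
Qed.

Lemma parts_discrete W : discrete W \in parts W.
Proof.
apply/partsP; split; first exact: partition_discrete.
by move=> A /imsetP[v _ ->]; apply: independent1.
Qed.

Lemma parts_clique W : {in W &, forall u v, u != v -> adj u v} ->
  parts W = [set discrete W].
Proof.
move=> cliqueW; apply/setP => P; rewrite in_set1.
apply/idP/eqP => [/partsP[parP indP]|->]; last exact: parts_discrete.
have cell1 v A : A \in P -> v \in A -> A = [set v].
  move=> AP vA; have [_ /subsetP sAW] := partition_cell parP AP.
  apply/setP => w; rewrite inE; apply/idP/eqP => [wA|-> //].
  apply/eqP; apply: contraTT (indP A AP) => neq_wv.
  apply/negP => /independentP/(_ w v wA vA).
  by rewrite cliqueW ?sAW.
apply/setP => A; apply/idP/imsetP => [AP|[v vW ->]].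
  have [A0 /subsetP sAW] := partition_cell parP AP.
  have [v vA] := set0Pn _ A0; exists v; first exact: sAW.
  exact: cell1.
have: v \in cover P by rewrite (cover_partition parP).
by case/bigcupP=> B BP vB; rewrite -(cell1 v B).
Qed.

(** * The fibres of the deletion of a free pair *)

Section Fibre.
Variables (W : {set G}) (x y : G).
Hypotheses (xW : x \notin W) (yW : y \notin W) (neq_xy : x != y).
Hypothesis nadj_xy : ~~ adj x y.

Let yxW : y \notin x |: W.
Proof. by rewrite !inE negb_or eq_sym neq_xy. Qed.

Definition room z q : {set {set G}} := [set C in q | independent (z |: C)].

(** The cell that y joins if x has joined A and y is to join the cell B of q: when
A and B are the same non-empty cell, x is already in it. *)
Definition host A B : {set G} := if (B == A) && (A != set0) then x |: A else B.

(** The partition that belongs to a vertex of the rook graph: rows are the cells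
for x, columns those for y, the empty set stands for a singleton, and [None] is the
partition with cell {x, y}. *)
Definition seat q (p : option ({set G} * {set G})) : {set {set G}} :=
  if p is Some (A, B) then place (place q x A) y (host A B)
  else place (place q x set0) y [set x].

Definition seats q := board set0 set0 (room x q) (room y q).

Definition fibre q : {set {set {set G}}} :=
  [set R in parts (y |: (x |: W)) | restr (restr R y) x == q].

Lemma room_slot z q A : q \in parts W -> (A \in set0 |: room z q) =
  (A \in set0 |: q) && independent (z |: A).
Proof.
move=> qW; rewrite !inE; case: eqVneq => [->|] //=.
by rewrite setU0 independent1.
Qed.

Lemma mem_seats q A B : q \in parts W -> (Some (A, B) \in seats q) =
  [&& A \in set0 |: q, independent (x |: A), B \in set0 |: q & independent (y |: B)].
Proof. by move=> qW; rewrite in_setU1 /= inE !room_slot // -andbA. Qed.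

Section OneFibre.
Variable q : {set {set G}}.
Hypothesis qW : q \in parts W.
Let parq := parts_partition qW.

Lemma partition_place_x A : A \in set0 |: q -> partition (place q x A) (x |: W).
Proof. exact: partition_place. Qed.

Lemma place_slot A C : C \in set0 |: q -> C != A -> C \in set0 |: place q x A.
Proof.
rewrite !inE => /orP[->//|->] ->.
by rewrite !orbT.
Qed.

Lemma host_slot A B : A \in set0 |: q -> B \in set0 |: q ->
  host A B \in set0 |: place q x A.
Proof.
move=> slotA slotB; rewrite /host; case: eqVneq => [->|neqBA] /=.
  by case: eqVneq => [->|_] /=; rewrite !inE eqxx ?orbT.
exact: place_slot.
Qed.

Lemma host_D1 A B : A \in set0 |: q -> B \in set0 |: q -> host A B :\ x = B.
Proof.
move=> slotA slotB; rewrite /host.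
have xA := slot_notin parq xW slotA; have xB := slot_notin parq xW slotB.
by case: ifP => [/andP[/eqP-> _]|_]; rewrite ?setU1K ?setD1_notin.
Qed.

Lemma tau_slot : [set x] \in set0 |: place q x set0.
Proof. by rewrite !inE setU0 eqxx orbT. Qed.

Let slot0 P : set0 \in set0 |: P. Proof. exact: setU11. Qed.

Lemma restr_seat_y A B : A \in set0 |: q -> B \in set0 |: q ->
  restr (seat q (Some (A, B))) y = place q x A.
Proof.
move=> slotA slotB; apply: restr_place yxW _; first exact: partition_place_x.
exact: host_slot.
Qed.

Lemma restr_tau_y : restr (seat q None) y = place q x set0.
Proof. by apply: restr_place yxW tau_slot; apply: partition_place_x. Qed.

Lemma restr_seat_x A B : A \in set0 |: q -> B \in set0 |: q ->
  restr (seat q (Some (A, B))) x = place q y B.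
Proof.
move=> slotA slotB; rewrite (restr_place_neq (W := x |: W)) ?host_slot //.
  by rewrite (restr_place parq xW slotA) host_D1.
exact: partition_place_x.
Qed.

Lemma restr_tau_x : restr (seat q None) x = place q y set0.
Proof.
rewrite (restr_place_neq (W := x |: W)) ?tau_slot //; last exact: partition_place_x.
by rewrite (restr_place parq xW) // setDv.
Qed.

Lemma seat_inj : {in seats q &, injective (seat q)}.
Proof.
have neq_tau A B : Some (A, B) \in seats q -> seat q (Some (A, B)) <> seat q None.
  rewrite mem_seats // => /and4P[slotA _ slotB _] eq_seat.
  have A0 : A = set0.
    apply: (place_inj parq xW slotA (slot0 q)).
    by rewrite -restr_tau_y -eq_seat restr_seat_y.
  subst A; have /setP/(_ x) : host set0 B = [set x].
    apply: place_inj (partition_place_x (slot0 q)) yxW _ tau_slot eq_seat.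
    exact: host_slot.
  by rewrite /host eqxx andbF inE eqxx (negPf (slot_notin parq xW slotB)).
case=> [[A B]|] [[A' B']|] //.
- rewrite !mem_seats // => /and4P[slotA _ slotB _] /and4P[slotA' _ slotB' _] eq_seat.
  have eqA : A = A'.
    by apply: (place_inj parq xW) => //; rewrite -(restr_seat_y slotA slotB) eq_seat restr_seat_y.
  have eqB : B = B'.
    by apply: (place_inj parq yW) => //; rewrite -(restr_seat_x slotA slotB) eq_seat restr_seat_x.
  by rewrite eqA eqB.
- by move=> /neq_tau neq _ /neq.
- by move=> _ /neq_tau neq /esym/neq.
Qed.

(** Two seats in a row agree after deletion of y, two seats in a column after
deletion of x; deletion of y from the cell {x, y} leaves x alone, and vice versa, so
[None] fits into one row and one column. *)
Lemma seat_link : {in seats q &, forall p p', rook set0 set0 p p' -> link (seat q p) (seat q p')}.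
Proof.
case=> [[A B]|] [[A' B']|].
- rewrite !mem_seats // => /and4P[slotA _ slotB _] /and4P[slotA' _ slotB' _] /=.
  case/orP=> /eqP eqAB; [apply: (link_at (x := y)) | apply: (link_at (x := x))].
    by rewrite (restr_seat_y slotA slotB) (restr_seat_y slotA' slotB') eqAB.
  by rewrite (restr_seat_x slotA slotB) (restr_seat_x slotA' slotB') eqAB.
- rewrite mem_seats // => /and4P[slotA _ slotB _] _ /=.
  case/orP=> /eqP eqAB; [apply: (link_at (x := y)) | apply: (link_at (x := x))].
    by rewrite (restr_seat_y slotA slotB) restr_tau_y eqAB.
  by rewrite (restr_seat_x slotA slotB) restr_tau_x eqAB.
- rewrite mem_seats // => _ /and4P[slotA _ slotB _] /=.
  case/orP=> /eqP eqAB; [apply: (link_at (x := y)) | apply: (link_at (x := x))].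
    by rewrite (restr_seat_y slotA slotB) restr_tau_y eqAB.
  by rewrite (restr_seat_x slotA slotB) restr_tau_x eqAB.
- by move=> *; apply: (link_at (x := x)).
Qed.

(** Given an extension R of q, the rest of the cell of y is empty, a cell of q other
than that of x, or the whole cell of x. The last case gives [None] if x is alone in its
cell after the deletion of y, and a square (A, A) otherwise. *)
Lemma seat_imset : seat q @: seats q = fibre q.
Proof.
apply/setP => R; apply/imsetP/idP => [[[[A B]|] seatp ->]|].
- move: seatp; rewrite mem_seats // => /and4P[slotA indA slotB indB].
  rewrite inE restr_seat_y // (restr_place parq xW slotA) eqxx andbT.
  apply: parts_place yxW _ _; [exact: parts_place | exact: host_slot |].
  rewrite /host; case: ifP => // /andP[/eqP eqBA _]; subst B.
  move/independentP: indA => indA; move/independentP: indB => indB.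
  apply/independentP => u v; rewrite !in_setU1.
  case/or3P=> [/eqP->|/eqP->|uA] /or3P[/eqP->|/eqP->|vA];
    rewrite ?adj_irr ?nadj_xy // 1?adj_sym ?nadj_xy //;
    by [apply: indA; rewrite ?setU11 ?inE ?uA ?vA ?orbT
       |apply: indB; rewrite ?setU11 ?inE ?uA ?vA ?orbT].
- rewrite inE restr_tau_y (restr_place parq xW) // eqxx andbT.
  apply: parts_place yxW tau_slot _; first exact: (parts_place _ _ _ (independentU0 _)).
  by rewrite setUC independent2.
rewrite inE => /andP[RW /eqP defq]; case/partsP: (RW) => parR indR.
set Q := restr R y in defq.
have QW : Q \in parts (x |: W).
  by rewrite -(setU1K yxW); apply: parts_restr.
have yR : y \in y |: (x |: W) by rewrite setU11.
have defR := place_restr parR yR; rewrite -/Q in defR.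
set B := _ :\ y in defR.
have slotB : B \in set0 |: Q.
  by apply: slot_restr; rewrite in_setU1 pblock_mem ?orbT // (cover_partition parR).
have yB_R : y |: B \in R by rewrite -defR setU11.
have indB : independent (y |: B) by apply: indR.
have parQ := parts_partition QW.
have xQ : x \in x |: W by rewrite setU11.
have defQ := place_restr parQ xQ; rewrite defq in defQ.
set A := _ :\ x in defQ.
have slotA : A \in set0 |: q.
  by rewrite -defq; apply: slot_restr; rewrite in_setU1 pblock_mem ?orbT // (cover_partition parQ).
have xA_Q : x |: A \in Q by rewrite -defQ setU11.
have indA : independent (x |: A) by case/partsP: QW => _; apply.
(* A and B are now the companions of x and of y. *)
have [B_xA|neqB] := eqVneq B (x |: A).
  have [A0|A0] := eqVneq A set0.
    exists None; first by rewrite !inE.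
    by rewrite /= -[R]defR -defQ B_xA A0 setU0.
  exists (Some (A, A)); last by rewrite /= /host eqxx A0 -B_xA defQ defR.
  rewrite mem_seats // slotA indA /=; apply: independentS indB.
  by rewrite B_xA setUS // subsetUr.
exists (Some (A, B)).
  rewrite mem_seats // slotA indA indB andbT /=.
  move: slotB; rewrite -defQ !in_setU1 (negPf neqB) /= in_setD1.
  by case/orP=> [->//|/andP[_ ->]]; rewrite orbT.
rewrite /= /host; case: ifP => [/andP[/eqP eqBA A0]|_]; last by rewrite defQ defR.
have BQ : B \in Q by move: slotB; rewrite in_setU1 eqBA (negPf A0) .
have [z zA] := set0Pn _ A0.
have zB : z \in B by rewrite eqBA.
have zxA : z \in x |: A by rewrite in_setU1 zA orbT.
by rewrite (cell_eq parQ BQ xA_Q zB zxA) eqxx in neqB.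
Qed.

Lemma set0_room z : set0 \notin room z q.
Proof. by rewrite inE (partition0 parq). Qed.

Lemma ham_seat u v : ham_path (rook set0 set0) (seats q) u v ->
  ham_path link (fibre q) (seat q u) (seat q v).
Proof. by rewrite -seat_imset; apply: ham_path_imset; [apply: seat_inj | apply: seat_link]. Qed.

Definition apart := seat q (Some (set0, set0)).
Definition joined := seat q None.
Definition beside t := seat q (Some ([set t], set0)).

Lemma ham_fibre : ham_path link (fibre q) apart joined.
Proof. by apply/ham_seat/ham_board; apply: set0_room. Qed.

Lemma room_single t : [set t] \in q -> ~~ adj x t -> [set t] \in room x q.
Proof. by rewrite inE => -> nadj; rewrite independent2. Qed.

Lemma ham_fibre_origin t : [set t] \in q -> ~~ adj x t ->
  ham_path link (fibre q) apart (beside t).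
Proof. by move=> tq nadj; apply/ham_seat/ham_board_origin; rewrite ?set0_room ?room_single. Qed.

Lemma ham_fibre_joined t : [set t] \in q -> ~~ adj x t ->
  ham_path link (fibre q) (beside t) joined.
Proof. by move=> tq nadj; apply/ham_seat/ham_board_None; rewrite ?set0_room ?room_single. Qed.

Lemma link_joined_apart : link joined apart.
Proof.
by apply: (link_at (x := y)); rewrite restr_tau_y restr_seat_y.
Qed.

End OneFibre.

Lemma restr_seat_other q A t : q \in parts W -> t != x -> t != y -> A \in set0 |: q ->
  restr (seat q (Some (A, set0))) t = place (place (restr q t) x (A :\ t)) y set0.
Proof.
move=> qW neq_tx neq_ty slotA; have parq := parts_partition qW.
have host0 : host A set0 = set0 by rewrite /host; case: eqVneq => [<-|] //; rewrite eqxx.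
rewrite /= host0 (restr_place_neq (W := x |: W)) ?setU11 //; last exact: partition_place.
by rewrite (restr_place_neq parq) // set0D.
Qed.

Lemma restr_joined_other q t : q \in parts W -> t != x -> t != y ->
  restr (joined q) t = place (place (restr q t) x set0) y [set x].
Proof.
move=> qW neq_tx neq_ty; have parq := parts_partition qW.
rewrite /joined /= (restr_place_neq (W := x |: W)) ?tau_slot //; last first.
  by apply: partition_place; rewrite ?setU11.
by rewrite (restr_place_neq parq) ?setU11 // set0D setD1_notin // inE.
Qed.

(** A link between partitions of W that is witnessed by x or y, which are not in
W, can only be an equality. *)
Lemma link_eq_or q q' : q \in parts W -> q' \in parts W -> link q q' ->
  q = q' \/ exists t, [/\ t != x, t != y & restr q t = restr q' t].
Proof.
move=> /parts_partition parq /parts_partition parq' /existsP[t /eqP eqt].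
have [tW|tW] := boolP (t \in W); last first.
  by left; rewrite -(restr_notin parq tW) eqt (restr_notin parq' tW).
right; exists t; split=> //; by [apply: contraNneq xW => <- | apply: contraNneq yW => <-].
Qed.

(** The two levels that exist in every fibre; [b] alternates along a zigzag. *)
Definition side (b : bool) q := if b then joined q else apart q.

Lemma link_side b q q' : q \in parts W -> q' \in parts W -> link q q' ->
  link (side b q) (side b q').
Proof.
move=> qW q'W /(link_eq_or qW q'W)[-> | [t [neq_tx neq_ty eqt]]].
  exact: (link_at (x := x)).
apply: (link_at (x := t)); case: b; rewrite /side.
  by rewrite !restr_joined_other ?eqt.
by rewrite !restr_seat_other ?eqt // setU11.
Qed.

Lemma link_beside t q q' : q \in parts W -> q' \in parts W -> link q q' ->
  [set t] \in q -> [set t] \in q' -> link (beside q t) (beside q' t).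
Proof.
move=> qW q'W /(link_eq_or qW q'W)[-> _ _ | [s [neq_sx neq_sy eqs]] tq tq'].
  exact: (link_at (x := x)).
have [parq parq'] := (parts_partition qW, parts_partition q'W).
have [eq_st|neq_st] := eqVneq s t.
  subst s; rewrite -[q](place_restr_single parq tq) eqs (place_restr_single parq' tq').
  exact: (link_at (x := x)).
apply: (link_at (x := s)).
rewrite !restr_seat_other ?eqs // in_setU1 ?tq ?tq' ?orbT //.
Qed.

Lemma link_beside_apart t q q' : q \in parts W -> q' \in parts W -> t \in W ->
  restr q t = restr q' t -> [set t] \in q -> link (beside q t) (apart q').
Proof.
move=> qW q'W tW eqt tq; apply: (link_at (x := t)).
have neq_tx : t != x by apply: contraNneq xW => <-.
have neq_ty : t != y by apply: contraNneq yW => <-.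
rewrite !restr_seat_other ?eqt // ?setU11 // ?in_setU1 ?tq ?orbT //.
by rewrite setDv set0D.
Qed.

Lemma ham_side b q : q \in parts W -> ham_path link (fibre q) (side b q) (side (~~ b) q).
Proof.
move=> qW; have ham_q := ham_fibre qW.
by case: b => //; apply: ham_path_rev ham_q; apply: link_sym.
Qed.

Definition fibres (Z : seq {set {set G}}) : {set {set {set G}}} :=
  [set R in parts (y |: (x |: W)) | restr (restr R y) x \in Z].

Lemma fibres_cons q Z : fibres (q :: Z) = fibre q :|: fibres Z.
Proof. by apply/setP => R; rewrite !inE -andb_orr. Qed.

Lemma disjoint_fibres q Z : q \notin Z -> [disjoint fibre q & fibres Z].
Proof.
move=> qZ; apply/pred0P => R /=; rewrite !in_set; apply/negP.
by case/andP=> /andP[_ /eqP->] /andP[_]; apply/negP.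
Qed.

Lemma fibres_all Z : Z =i parts W -> fibres Z = parts (y |: (x |: W)).
Proof.
move=> memZ; apply/setP => R; rewrite in_set memZ; apply: andb_idr => RW.
have := parts_restr x (parts_restr y RW).
by rewrite (setU1K yxW) (setU1K xW).
Qed.

(** Each fibre is crossed from one side to the other, and the next fibre is entered
on the side where the previous one was left. *)
Lemma ham_zigzag b q Z : path link q Z -> uniq (q :: Z) ->
  {subset q :: Z <= parts W} ->
  ham_path link (fibres (q :: Z)) (side b q)
    (side (b (+) ~~ odd (size Z)) (last q Z)).
Proof.
elim: Z b q => [|q' Z IHZ] b q.
  move=> _ _ sZ; rewrite fibres_cons.
  have -> : fibres [::] = set0 by apply/setP => R; rewrite !inE andbF.
  by rewrite setU0 addbT; apply: ham_side; apply: sZ; rewrite inE.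
rewrite [path _ _ _]/= => /andP[link_qq' pathZ] /andP[qZ uniqZ] sZ.
have qW : q \in parts W by apply: sZ; rewrite inE eqxx.
have sZ' : {subset q' :: Z <= parts W} by move=> r rZ; apply: sZ; rewrite inE rZ orbT.
have q'W : q' \in parts W by apply: sZ'; rewrite inE eqxx.
rewrite fibres_cons; apply: ham_path_cat (disjoint_fibres qZ) _ (ham_side b qW) _.
  exact: link_side link_qq'.
have := IHZ (~~ b) q' pathZ uniqZ sZ'.
by rewrite /= addNb !addbN.
Qed.

End Fibre.

(** * The induction on the vertex set *)

(** Stated with paths so that a set of one or two partitions is included. *)
Definition cyclable W :=
  exists u v, ham_path link (parts W) u v /\ link v u.

Lemma cyclableP W : cyclable W <-> exists u s,
  [/\ cycle link (u :: s), uniq (u :: s) & u :: s =i parts W].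
Proof.
split=> [[u [v [[s [ps ls us ms]] link_vu]]]|[u [s []]]].
  by exists u, s; split=> //; rewrite /= rcons_path ps ls.
rewrite /= rcons_path => /andP[ps link_s] us ms.
by exists u, (last u s); split=> //; exists s; split.
Qed.

(** Only an odd cycle of length at least 3 needs the vertex t: an even one is
closed up by the zigzag itself, and over a single partition the ends of the path in
its only fibre are linked. *)
Lemma cyclable_add W x y : x \notin W -> y \notin W -> x != y -> ~~ adj x y ->
  cyclable W ->
  (odd #|parts W| -> 1 < #|parts W| -> exists2 t, t \in W & ~~ adj x t) ->
  cyclable (y |: (x |: W)).
Proof.
move=> xW yW neq_xy nadj_xy /cyclableP[u [s [cyc_s uniq_s mem_s]]] extra.
have card_s : #|parts W| = (size s).+1.
  by rewrite -(eq_card mem_s); apply/card_uniqP.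
have sub_s : {subset u :: s <= parts W} by move=> q; rewrite mem_s.
have uW : u \in parts W by rewrite -mem_s inE eqxx.
move: (cyc_s); rewrite /= rcons_path => /andP[path_s link_su].
have ham_s := ham_zigzag xW yW neq_xy nadj_xy false path_s uniq_s sub_s.
rewrite (fibres_all xW yW neq_xy mem_s) in ham_s.
have [odd_s|even_s] := boolP (odd (size s)).
  rewrite odd_s in ham_s; exists (apart x y u), (apart x y (last u s)); split=> //.
  apply: (link_side xW yW false _ _ link_su) => //.
  by apply: sub_s; apply: mem_last.
have [s0|s_gt0] := posnP (size s).
  move/size0nil: s0 => s0; subst s.
  exists (apart x y u), (joined x y u); split; first exact: ham_s.
  exact (link_joined_apart xW yW neq_xy uW).
have [||t tW nadj_xt] := extra; rewrite ?card_s //=.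
(* Start the cycle at D; by parity at least two partitions follow it. *)
set D := discrete W; have DW : D \in parts W := parts_discrete W.
have [|i s' rot_s] := @rot_to _ (u :: s) D; first by rewrite mem_s.
have size_s' : size s' = size s.
  by move/(congr1 size): rot_s; rewrite size_rot => -[].
have {cyc_s} cyc_s' : cycle link (D :: s') by rewrite -rot_s rot_cycle.
have {uniq_s} uniq_s' : uniq (D :: s') by rewrite -rot_s rot_uniq.
have {mem_s} mem_s' : D :: s' =i parts W by move=> q; rewrite -rot_s mem_rot mem_s.
case: s' => [|q1 [|q2 Z]] in size_s' cyc_s' uniq_s' mem_s' {rot_s}.
- by rewrite -size_s' in s_gt0.
- by rewrite -size_s' in even_s.
have {size_s' even_s} even_Z : ~~ odd (size Z) by rewrite -size_s' /= negbK in even_s.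
have q1W : q1 \in parts W by rewrite -mem_s' !inE eqxx orbT.
have q2W : q2 \in parts W by rewrite -mem_s' !inE eqxx !orbT.
have sub_Z : {subset q2 :: Z <= parts W}.
  by move=> q qZ; rewrite -mem_s' 2!inE qZ !orbT.
move: (cyc_s'); rewrite /= rcons_path => /and4P[link_D1 link_12 path_Z link_ZD].
move: (uniq_s') => /and3P[D_notin q1_notin uniq_Z].
have tD : [set t] \in D by rewrite mem_discrete.
rewrite /cyclable.
have -> : parts (y |: (x |: W)) =
   fibre W x y q1 :|: (fibres W x y (q2 :: Z) :|: fibre W x y D).
  rewrite -(fibres_all xW yW neq_xy mem_s') (fibres_cons _ _ _ D) (fibres_cons _ _ _ q1).
  by rewrite [RHS]setUA setUC.
(* The order is q1, then q2 and its successors, then D. As an odd number of fibres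
   is crossed between q1 and D, the fibre of D is entered on the side apart. *)
have [m link_m ham_m] : exists2 m, link (beside x y D t) m
    & ham_path link (fibre W x y q1) m (joined x y q1).
  have [tq1|tq1] := boolP ([set t] \in q1).
    exists (beside x y q1 t); first exact (link_beside xW yW DW q1W link_D1 tD tq1).
    exact: ham_fibre_joined.
  exists (apart x y q1); last exact: ham_fibre.
  have eq_t := link_discrete (parts_partition q1W) tW link_D1 tq1.
  exact (link_beside_apart xW yW DW q1W tW eq_t tD).
exists m, (beside x y D t); split=> //.
apply: ham_path_cat ham_m _.
- rewrite setUC -fibres_cons; apply: disjoint_fibres; rewrite inE negb_or q1_notin andbT.
  by move: D_notin; rewrite inE negb_or eq_sym => /andP[].
- exact (link_side xW yW true q1W q2W link_12).
have := ham_zigzag xW yW neq_xy nadj_xy true path_Z uniq_Z sub_Z.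
rewrite (negPf even_Z) /= => ham_Z.
apply: ham_path_cat ham_Z (ham_fibre_origin xW yW neq_xy nadj_xy DW tD nadj_xt).
- rewrite disjoint_sym; apply: disjoint_fibres.
  by move: D_notin; rewrite inE negb_or => /andP[].
- by apply: (link_side xW yW false) link_ZD => //; apply: sub_Z; apply: mem_last.
Qed.

(** Neither x nor y can join any other cell, so every fibre consists of [apart q]
and [joined q]. *)
Lemma even_parts W x y : x \notin W -> y \notin W -> x != y -> ~~ adj x y ->
  {in W, forall t, adj x t && adj y t} -> ~~ odd #|parts (y |: (x |: W))|.
Proof.
move=> xW yW neq_xy nadj_xy isolated.
have room0 z q : z \in [:: x; y] -> q \in parts W -> room z q = set0.
  move=> zxy /parts_partition parq; apply/setP => C; rewrite !inE.
  apply/negP => /andP[Cq /independentP indC].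
  have [C0 /subsetP sCW] := partition_cell parq Cq; have [t tC] := set0Pn _ C0.
  have := indC z t; rewrite !inE eqxx tC orbT => /(_ isT isT).
  by move: zxy (isolated t (sCW t tC)); rewrite !inE => /orP[]/eqP-> /andP[adj_xt adj_yt]; rewrite ?adj_xt ?adj_yt.
have card_fibre q : q \in parts W -> #|fibre W x y q| = 2.
  move=> qW; rewrite -(seat_imset xW yW neq_xy nadj_xy qW).
  rewrite card_in_imset; last exact: (seat_inj xW yW neq_xy qW).
  rewrite /seats !room0 // ?in_cons ?eqxx ?orbT //.
  rewrite (_ : board _ _ _ _ = [set None; Some (set0, set0)]) ?cards2 //.
  by apply/setP => -[[A B]|]; rewrite !inE ?orbF.
rewrite -sum1_card (partition_big (fun R => restr (restr R y) x) (mem (parts W))) /=.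
  rewrite (eq_bigr (fun=> 2)) ?sum_nat_const ?oddM ?andbF // => q qW.
  rewrite -(card_fibre q qW) -sum1_card; apply: eq_bigl => R.
  by rewrite [R \in fibre _ _ _ _]inE.
move=> R RW; have := parts_restr x (parts_restr y RW).
have yxW : y \notin x |: W by rewrite !inE negb_or eq_sym neq_xy.
by rewrite (setU1K yxW) (setU1K xW).
Qed.

Lemma cyclable_clique W (x0 : G) :
  {in W &, forall u v, u != v -> adj u v} -> cyclable W.
Proof.
move=> cliqueW; exists (discrete W), (discrete W); rewrite parts_clique //.
by split; [apply: ham_path1 | apply: (link_at (x := x0))].
Qed.

Lemma cyclable_parts W (x0 : G) : cyclable W.
Proof.
have [n leWn] := ubnP #|W|; elim: n => // n IHn in W leWn *.
have noncliqueP (V : {set G}) : {in V &, forall u v, u != v -> adj u v} \/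
    exists u v, [/\ u \in V, v \in V, u != v & ~~ adj u v].
  have [/existsP[u /existsP[v /and4P[]]]|cliqueV] :=
    boolP [exists u, exists v, [&& u \in V, v \in V, u != v & ~~ adj u v]].
    by right; exists u, v.
  left=> u v uV vV neq_uv; apply: contraR cliqueV => nadj.
  by apply/existsP; exists u; apply/existsP; exists v; rewrite uV vV neq_uv.
have split_pair x y : x \in W -> y \in W -> x != y ->
    [/\ x \notin W :\ x :\ y, y \notin W :\ x :\ y,
        W = y |: (x |: W :\ x :\ y) & cyclable (W :\ x :\ y)].
  move=> xW yW neq_xy; split; try by rewrite !inE eqxx ?andbF.
    by rewrite setUCA setD1K ?setD1K // !inE eq_sym neq_xy.
  apply: IHn; rewrite (cardsD1 x W) xW in leWn.
  have ltWn : #|W :\ x| < n by [].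
  by apply: leq_ltn_trans ltWn; apply/subset_leq_card/subsetDl.
have [|[x [y [xW yW neq_xy nadj_xy]]]] := noncliqueP W; first exact: cyclable_clique.

have [/exists_inP[u uW /exists_inP[v vW /exists_inP[t tW /and5P[]]]]|no_path] := boolP
  [exists u in W, exists v in W, exists t in W,
    [&& u != v, t != u, t != v, ~~ adj u v & ~~ adj u t]].
  move=> neq_uv neq_tu neq_tv nadj_uv nadj_ut.
  have [uW' vW' defW cycW'] := split_pair u v uW vW neq_uv; rewrite defW.
  apply: (cyclable_add uW' vW' neq_uv nadj_uv cycW') => _ _; exists t => //.
  by rewrite !inE neq_tu neq_tv.
have [xW' yW' defW cycW'] := split_pair x y xW yW neq_xy.
rewrite defW.
apply: (cyclable_add xW' yW' neq_xy nadj_xy cycW') => odd_parts parts_gt1; exfalso.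
have [cliqueW'|[u [v [uW' vW' neq_uv nadj_uv]]]] := noncliqueP (W :\ x :\ y).
  by rewrite parts_clique // cards1 in parts_gt1.
(* From here on, free pairs inside W are pairwise disjoint. *)
have adj_path a b c : a \in W -> b \in W -> c \in W -> a != b -> c != a -> c != b ->
    ~~ adj a b -> adj a c.
  move=> aW bW cW neq_ab neq_ca neq_cb nadj_ab; apply: contraR no_path => nadj_ac.
  apply/exists_inP; exists a => //; apply/exists_inP; exists b => //.
  by apply/exists_inP; exists c; rewrite ?neq_ab ?neq_ca ?neq_cb ?nadj_ab.
have sW'W : {subset W :\ x :\ y <= W} by move=> a; rewrite !inE => /and3P[].
set W' := W :\ x :\ y in uW' vW' odd_parts sW'W.
have defW' : W' = v |: (u |: W' :\ u :\ v).
  by rewrite setUCA setD1K ?setD1K // in_setD1 eq_sym neq_uv.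
have nadj_vu : ~~ adj v u by rewrite adj_sym.
move: odd_parts; rewrite defW'; apply/negP.
apply: even_parts => // [||t]; try by rewrite !inE eqxx ?andbF.
case/setD1P=> neq_tv /setD1P[neq_tu tW'].
have [uW vW] := (sW'W u uW', sW'W v vW'); have tW := sW'W t tW'.
apply/andP; split; [exact: (adj_path u v) | apply: (adj_path v u) => //].
by rewrite eq_sym.
Qed.

Lemma card_parts_gt2 x y u v : x != y -> ~~ adj x y -> u != v -> ~~ adj u v ->
  [set u; v] != [set x; y] -> 2 < #|parts [set: G]|.
Proof.
move=> neq_xy nadj_xy neq_uv nadj_uv neq_pairs.
have not1 a b W : a != b -> [set a; b] \notin discrete W.
  move=> neq_ab; apply/imsetP => -[c _ eq_c].
  have /eqP := congr1 (fun A => #|A|) eq_c.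
  by rewrite cards2 neq_ab cards1.
pose merged (a b : G) := place (discrete (~: [set a])) a [set b].
have mergedP (a b : G) : a != b -> ~~ adj a b -> merged a b \in parts [set: G].
  move=> neq_ab nadj_ab; rewrite -(setUCr [set a]); apply: parts_place.
  - exact: parts_discrete.
  - by rewrite !inE eqxx.
  - by rewrite in_setU1 mem_discrete !inE [b == a]eq_sym neq_ab orbT.
  - by rewrite independent2.
have pair_merged (a b : G) : [set a; b] \in merged a b by rewrite setU11.
have neqD (a b : G) : a != b -> discrete setT != merged a b.
  move=> neq_ab; apply: contraTneq (pair_merged a b) => <-; exact: not1.
have neqM : merged x y != merged u v.
  apply: contraTneq (pair_merged u v) => <-.
  rewrite in_setU1 in_setD1 (negPf neq_pairs) /=.
  by rewrite (negPf (not1 _ _ _ neq_uv)) andbF.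
pose three := [:: discrete setT; merged x y; merged u v].
have uniq3 : uniq three by rewrite /= !inE negb_or !neqD ?neqM.
rewrite cardE; apply: (uniq_leq_size uniq3) => P; rewrite mem_enum !in_cons orbF.
by case/or3P=> /eqP->; rewrite ?parts_discrete ?mergedP.
Qed.

Lemma stable_partitionE n P : #|G| = n ->
  stable_partition n P = (P \in parts [set: G]).
Proof.
move=> cardG; rewrite inE /stable_partition; case: (boolP (partition _ _)) => //= parP.
suff -> : #|P| <= n by [].
rewrite -cardG -cardsT (card_partition parP) -sum1_card leq_sum // => A AP.
by rewrite card_gt0; case: (partition_cell parP AP).
Qed.

End Stable.

(** * Hamiltonicity of the Bell colour graph *)

Lemma path_uniq_neq (T : eqType) (e : rel T) u s : path e u s -> uniq (u :: s) ->
  path (fun v w => (v != w) && e v w) u s.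
Proof.
elim: s u => //= v s IHs u /andP[-> path_s] /andP[uvs uniq_s].
by rewrite IHs // !andbT; apply: contraNneq uvs => ->; rewrite inE eqxx.
Qed.

Lemma cycle_uniq_neq (T : eqType) (e : rel T) s : 1 < size s ->
  cycle e s -> uniq s -> cycle (fun v w => (v != w) && e v w) s.
Proof.
case: s => // u s; case/lastP: s => // s v _.
rewrite /= !(rcons_path _ u (rcons s v)) last_rcons => /andP[path_s ->] uniq_s.
rewrite path_uniq_neq //= andbT; apply: contraTneq uniq_s => ->.
by rewrite mem_rcons inE eqxx.
Qed.

Theorem theorem3p1 (n : nat) (G : sgraph) (cardG : #|G| = n)
  (not_complete : ~ is_complete G)
  (not_complete_minus_edge : ~ is_complete_minus_edge G) :
  hamiltonian (bell_colour_graph n G).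
Proof.
have [x [y [neq_xy nadj_xy]]] : exists x y : G, x != y /\ ~~ adj x y.
  have [/existsP[x /existsP[y /andP[]]]|no_pair] :=
    boolP [exists x : G, exists y, (x != y) && ~~ adj x y]; first by exists x, y.
  case: not_complete => u v; have [->|neq_uv] := eqVneq u v; first exact: adj_irr.
  apply: (contraR _ no_pair) => nadj; apply/existsP; exists u; apply/existsP; exists v.
  by rewrite neq_uv.
have [u [v [neq_uv nadj_uv neq_pairs]]] : exists u v : G,
    [/\ u != v, ~~ adj u v & [set u; v] != [set x; y]].
  have [/existsP[u /existsP[v /and3P[]]]|no_pair] := boolP
    [exists u : G, exists v, [&& u != v, ~~ adj u v & [set u; v] != [set x; y]]].
    by exists u, v.
  case: not_complete_minus_edge; exists x, y; split=> // u v.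
  have [->|neq_uv] := eqVneq u v; first exact: adj_irr.
  have [eq_pairs|neq_pairs] := eqVneq [set u; v] [set x; y].
    by rewrite andbF; apply/negbTE; rewrite -independent2 eq_pairs independent2.
  apply: (contraR _ no_pair) => nadj; apply/existsP; exists u; apply/existsP; exists v.
  by rewrite neq_uv nadj.
have [p [s [cyc_s uniq_s mem_s]]] := (cyclableP _).1 (cyclable_parts [set: G] x).
have gt2 : 2 < size (p :: s).
  rewrite -(card_uniqP uniq_s) (eq_card mem_s).
  exact: card_parts_gt2 neq_xy nadj_xy neq_uv nadj_uv neq_pairs.
pose s' : seq (bell_colour_graph n G) := pmap insub (p :: s).
have val_s' : map val s' = p :: s.
  rewrite (pmap_filter (insubK _)); apply/all_filterP/allP => P.
  by rewrite mem_s -(stable_partitionE _ cardG) => stP; rewrite insubT.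
exists s'; split.
- by rewrite -(size_map val) val_s'.
- rewrite /ucycle -(map_inj_uniq val_inj) val_s' uniq_s andbT.
  have := cycle_uniq_neq (ltnW gt2) cyc_s uniq_s.
  by rewrite -val_s' cycle_map.
- move=> P; rewrite -(mem_map val_inj) val_s' mem_s -(stable_partitionE _ cardG).
  exact: valP.
Qed.
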